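(* For all integers $n,m\geqslant 0$, there is a bijection between the set of maximal chains in the poset $\Sigma_mC^n_m$ and the set of walks of length $(n+1)m$ in $C^n_m=\{0,\dots,m\}^n$ that start and end at $(0,\dots,0)$ and use only the steps $(1,1,\dots,1)$, $(-1,0,\dots,0)$, $(0,-1,\dots,0)$, $\dots$, $(0,0,\dots,-1)$.
   Context: $C_r$ is the chain $\{0<1<\dots<r\}$ and $C^n_r$ its $n$-th cartesian power with componentwise order. For fixed $n$, consider the sequence $C^n_0\to C^n_1\to\dots\to C^n_m$ where each map $C^n_r\to C^n_{r+1}$ is the coordinatewise inclusion (induced by including $C_r$ as the down-set $\{0,\dots,r\}$ of $C_{r+1}$). $\Sigma_mC^n_m$ is the stacking (lax sum) of this sequence: the poset of pairs $(x,j)$ with $0\leqslant j\leqslant m$, $x\in C^n_j$, ordered by $(x,j)\leqslant(y,l)$ iff $j\leqslant l$ and $x\leqslant y$ in $C^n_l$. A walk in $C^n_m$ is a sequence of points of $\{0,\dots,m\}^n$ in which consecutive points differ by one of the allowed steps. *)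

(* Defs.v *)
From HB Require Import structures.
From mathcomp Require Import all_boot all_order all_algebra.

Set Implicit Arguments.
Unset Strict Implicit.
Unset Printing Implicit Defensive.

Import Order.TTheory GRing.Theory.

(* [C_r] is ['I_r.+1]; [cube n r] carries the componentwise order. *)
Notation cube n r := (n.-tupleprod 'I_r.+1).

Definition cube_incl n r s (le_rs : r <= s) (x : cube n r) : cube n s :=
  [tuple widen_ord (le_rs : r.+1 <= s.+1) (tnth x i) | i < n].

(* The pair [(x, j)] is [Tagged _ x] with tag [j]. The alias is needed because
   sigma types already carry a lexicographic order in the library. *)
Definition stacking n m : Type := {j : 'I_m.+1 & cube n j}.

HB.instance Definition _ n m := Finite.on (stacking n m).

Section StackingOrder.
Variables n m : nat.
Implicit Types p q : stacking n m.

Definition stacking_le p q : bool :=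
  if @idP (tag p <= tag q) is ReflectT le_pq
  then (cube_incl le_pq (tagged p) <= tagged q)%O else false.

Lemma stacking_leE p q :
  stacking_le p q =
  (tag p <= tag q) &&
    [forall i, (tnth (tagged p) i : nat) <= tnth (tagged q) i].
Proof.
set rhs := [forall i, _].
have inclE (h : tag p <= tag q) :
    (cube_incl h (tagged p) <= tagged q)%O = rhs.
  by rewrite leEtprod; apply: eq_forallb => i; rewrite leEord tnth_mktuple.
have ifE (P : Prop) b (r : reflect P b) F X : (forall h : P, F h = X) ->
    (if r is ReflectT h then F h else false) = b && X.
  by case: r => // h ->.
exact: ifE.
Qed.

Lemma stacking_leP p q :
  reflect (exists le_pq : tag p <= tag q,
             (cube_incl le_pq (tagged p) <= tagged q)%O)
          (stacking_le p q).
Proof.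
have inclE (h : tag p <= tag q) :
    (cube_incl h (tagged p) <= tagged q)%O =
    [forall i, (tnth (tagged p) i : nat) <= tnth (tagged q) i].
  by rewrite leEtprod; apply: eq_forallb => i; rewrite leEord tnth_mktuple.
rewrite stacking_leE; apply: (iffP andP) => [[h le_xy]|[h]].
  by exists h; rewrite inclE.
by rewrite inclE.
Qed.

Fact stacking_le_refl : reflexive stacking_le.
Proof. by move=> p; rewrite stacking_leE leqnn; apply/forallP. Qed.

Fact stacking_le_anti : antisymmetric stacking_le.
Proof.
move=> [j x] [l y]; rewrite !stacking_leE /=.
case/andP=> /andP[jl /forallP xy] /andP[lj /forallP yx].
have ejl : j = l by apply/val_inj/eqP; rewrite eqn_leq jl.
case: _ / ejl y xy yx {jl lj} => y xy yx.
congr existT; apply: eq_from_tnth => i.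
by apply/val_inj/eqP; rewrite eqn_leq xy yx.
Qed.

Fact stacking_le_trans : transitive stacking_le.
Proof.
move=> q p r; rewrite !stacking_leE => /andP[pq /forallP xy] /andP[qr /forallP yz].
by rewrite (leq_trans pq qr); apply/forallP => i; apply: leq_trans (xy i) (yz i).
Qed.

End StackingOrder.

Fact stacking_display : Order.disp_t. Proof. exact: Order.Disp tt tt. Qed.

HB.instance Definition _ n m :=
  Order.Le_isPOrder.Build stacking_display (stacking n m)
    (@stacking_le_refl n m) (@stacking_le_anti n m) (@stacking_le_trans n m).

Definition is_chain d (P : finPOrderType d) (A : {set P}) : bool :=
  [forall x in A, forall y in A, (x >=< y)%O].

(* [maxset] means maximal for inclusion. *)
Definition is_max_chain d (P : finPOrderType d) (A : {set P}) : bool :=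
  maxset (@is_chain d P) A.

Definition origin n m : cube n m := [tuple ord0 | i < n].

Definition zvec n m (x : cube n m) : 'rV[int]_n :=
  (\row_i Posz (tnth x i))%R.

Definition is_step n (v : 'rV[int]_n) : bool :=
  (v == const_mx 1%R) || [exists i, v == (- delta_mx ord0 i)%R].

Definition step_rel n m : rel (cube n m) :=
  fun x y => is_step (zvec y - zvec x)%R.

(* A walk with [k] steps is the tuple of its [k.+1] successive points. *)
Definition is_loop_walk n m k (w : k.+1.-tuple (cube n m)) : bool :=
  [&& sorted (@step_rel n m) w,
      tnth w ord0 == origin n m & tnth w ord_max == origin n m].

(* Main.v *)
(* Send a point (x, j) of the stacking to the vector of gaps (j - x_1, ..., j - x_n).
   A maximal chain is a path of covers from the bottom to the top. A cover either
   increments j, so that all gaps grow by 1, or increments one x_i, so that the i-th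
   gap drops by 1: gaps send maximal chains to closed walks. The stacking is graded
   by rank (x, j) = j + x_1 + ... + x_n, with top rank (n+1)m, and (n+1)j is
   rank (x, j) plus the sum of the gaps. Hence rank and gaps determine a point, which
   makes the map injective. For surjectivity, lift a walk step by step from the
   bottom: only a level exceeding m could obstruct this, and it does not occur, since
   a step lowers the sum of the gaps by at most 1, so this sum never exceeds the
   number of steps that remain before the return to the origin. *)
From HB Require Import structures.
Require Import Defs.
From mathcomp Require Import all_boot all_order all_algebra.
From mathcomp Require Import zify.

Set Implicit Arguments.
Unset Strict Implicit.
Unset Printing Implicit Defensive.

Import Order.TTheory.

Section Chains.
Variables (d : Order.disp_t) (P : finPOrderType d).
Implicit Types (p q r : P) (s : seq P) (A : {set P}).

Lemma chainP A : reflect {in A &, forall p q, (p >=< q)%O} (is_chain A).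
Proof.
apply: (iffP forall_inP) => [cA p q pA|cA p pA]; first exact/forall_inP/cA.
by apply/forall_inP => q; apply: cA.
Qed.

Lemma max_chainP A :
  reflect (is_chain A /\ forall p, {in A, forall q, (p >=< q)%O} -> p \in A)
          (is_max_chain A).
Proof.
apply: (iffP maxsetP) => -[chA maxA]; split=> //.
- move=> p cmp_pA; rewrite -(maxA (p |: A)) ?setU11 ?subsetUr //; apply/chainP.
  move=> q r /setU1P[->|qA] /setU1P[->|rA]; first exact: comparablexx.
  + exact: cmp_pA.
  + by rewrite comparable_sym cmp_pA.
  + exact: (chainP _ chA).
- move=> B chB sAB; apply/eqP; rewrite eqEsubset sAB andbT; apply/subsetP => p pB.
  by apply: maxA => q qA; apply: (chainP _ chB) => //; apply: (subsetP sAB).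
Qed.

Lemma chain_sorted_enum A : is_chain A -> sorted <%O (Order.enum A).
Proof.
move=> chA; rewrite lt_sorted_uniq_le Order.enum_uniq.
apply: (sort_sorted_in (P := mem A)); first by move=> p q; apply: (chainP _ chA).
by apply/allP => p; rewrite mem_enum.
Qed.

Lemma sorted_chain s : sorted <%O s -> is_chain [set p in s].
Proof.
move=> s_lt; apply/chainP => p q; rewrite !inE => ps qs.
rewrite -(nth_index p ps) -(nth_index p qs) /Order.comparable.
by rewrite !(lt_sorted_leq_nth p s_lt) ?inE ?index_mem // leq_total.
Qed.

Lemma enum_sorted s : sorted <%O s -> Order.enum [set p in s] = s.
Proof.
move=> s_lt; apply: lt_sorted_eq => // [|p]; last by rewrite Order.mem_enum inE.
exact/chain_sorted_enum/sorted_chain.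
Qed.

Definition covered_by p q : bool := (p < q)%O && [forall r, ~~ (p < r < q)%O].

Lemma covered_by_lt p q : covered_by p q -> (p < q)%O.
Proof. by case/andP. Qed.

Lemma covered_by_between p q r : covered_by p q -> (p <= r)%O -> (r < q)%O -> r = p.
Proof.
move=> /andP[_ /forallP/(_ r)]; rewrite le_eqVlt => npq /orP[/eqP//|pr rq].
by rewrite pr rq in npq.
Qed.

Lemma max_chain_sorted_covered A :
  is_max_chain A -> sorted covered_by (Order.enum A).
Proof.
case/max_chainP=> chA maxA; have s_lt := chain_sorted_enum chA.
case def_s: (Order.enum A) => [//|x0 s']; rewrite -{}def_s.
move: (Order.enum A) (Order.mem_enum A) s_lt => s mem_s s_lt.
have nth_le i j : i <= j -> j < size s -> (nth x0 s i <= nth x0 s j)%O.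
  move=> le_ij lt_j.
  by rewrite (lt_sorted_leq_nth x0 s_lt) ?inE // (leq_ltn_trans le_ij).
apply/(sortedP x0) => i lt_i; apply/andP; split.
  by rewrite (lt_sorted_ltn_nth x0 s_lt) ?inE // ltnW.
apply/forallP => r; apply/negP => /andP[lt_ir lt_ri].
have : r \in A.
  apply: maxA => q; rewrite -mem_s => qs; rewrite -(nth_index x0 qs).
  have [le_qi|lt_iq] := leqP (index q s) i.
    by rewrite ge_comparable // (le_trans (nth_le _ _ le_qi (ltnW lt_i))) // ltW.
  by rewrite le_comparable // (le_trans (ltW lt_ri)) // nth_le ?index_mem.
rewrite -mem_s => rs; move: lt_ir lt_ri; rewrite -(nth_index x0 rs).
by rewrite !(lt_sorted_ltn_nth x0 s_lt) ?inE ?index_mem //; lia.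
Qed.

Lemma mem_path_covered p r s : path covered_by p s ->
  (p <= r <= last p s)%O -> {in s, forall q, (r >=< q)%O} -> r \in p :: s.
Proof.
elim: s p => [|q s IHs] p /=; first by rewrite -eq_le inE eq_sym.
case/andP=> pq qs /andP[pr rs] cmp_r.
have [/(covered_by_between pq pr)->|qr] := comparable_ltP (cmp_r q (mem_head q s)).
  by rewrite mem_head.
rewrite in_cons IHs ?orbT ?qr // => x xs.
by apply: cmp_r; rewrite in_cons xs orbT.
Qed.

End Chains.

Arguments covered_by {d P} p q.

Section BoundedChains.
Variables (d : Order.disp_t) (P : finTBPOrderType d).
Implicit Types (s : seq P) (A : {set P}).

Lemma enum_max_chain A : is_max_chain A ->
  exists s, [/\ Order.enum A = \bot%O :: s, path covered_by \bot%O s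
              & last \bot%O s = \top%O].
Proof.
move=> maxA; have [chA memA] := max_chainP _ maxA.
have := max_chain_sorted_covered maxA; have := chain_sorted_enum chA.
have botA : \bot%O \in Order.enum A.
  by rewrite Order.mem_enum; apply: memA => q _; rewrite le_comparable.
have topA : \top%O \in Order.enum A.
  by rewrite Order.mem_enum; apply: memA => q _; rewrite ge_comparable.
case: (Order.enum A) botA topA => // p s botA topA /= s_lt s_cov.
have p_bot : p = \bot%O.
  move: botA; rewrite in_cons => /predU1P[//|bot_s].
  by have /allP/(_ _ bot_s) := order_path_min lt_trans s_lt; rewrite ltx0.
exists s; rewrite p_bot in s_cov topA s_lt *; split=> //.
case/splitPl: topA s_lt => s1 s2 top_s1; rewrite cat_path last_cat top_s1.
by case: s2 => //= q s2; rewrite lt1x andbF.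
Qed.

Lemma covered_path_max_chain s :
    path covered_by \bot%O s -> last \bot%O s = \top%O ->
  is_max_chain [set p in \bot%O :: s].
Proof.
move=> s_cov s_top; apply/max_chainP; split=> [|r cmp_r].
  by apply: sorted_chain; apply: sub_path s_cov; apply: covered_by_lt.
rewrite inE; apply: mem_path_covered => //; first by rewrite s_top le0x lex1.
by move=> q qs; apply: cmp_r; rewrite !inE qs orbT.
Qed.

End BoundedChains.

Lemma path_map_inj (T U : Type) (e : rel T) (f : T -> U) :
    (forall x y z, e x y -> e x z -> f y = f z -> y = z) ->
  forall x s t, path e x s -> path e x t -> map f s = map f t -> s = t.
Proof.
move=> inj_f x s; elim: s x => [|y s IHs] x [|z t] //= /andP[xy ys] /andP[xz zt].
case=> /(inj_f x y z xy xz) eq_yz; rewrite -{}eq_yz in zt *.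
by move/(IHs y t ys zt) ->.
Qed.

Lemma sum_nat_pred1 (I : finType) (i : I) : \sum_k (k == i : nat) = 1.
Proof. by rewrite -(big_mkcond (pred1 i) (fun=> 1)) big_pred1_eq. Qed.

Section Steps.
Variables n m : nat.
Implicit Types (c d : cube n m) (s : seq (cube n m)).

Definition weight c : nat := \sum_i tnth c i.

Lemma weight_origin : weight (origin n m) = 0.
Proof. by apply: big1 => i _; rewrite tnth_mktuple. Qed.

Lemma step_relP c d :
  reflect ((forall i, tnth d i = (tnth c i).+1 :> nat) \/
           exists i, forall k, tnth c k = tnth d k + (k == i) :> nat)
          (step_rel c d).
Proof.
rewrite /step_rel /is_step; apply: (iffP orP).
  case=> [/eqP/rowP vE|/existsP[i /eqP/rowP vE]]; [left=> i | right; exists i => k].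
    by have := vE i; rewrite !mxE; lia.
  by have := vE k; rewrite !mxE eqxx /=; case: (k == i) => /=; lia.
case=> [dE|[i cE]]; [left | right; apply/existsP; exists i].
  by apply/eqP/rowP => i; rewrite !mxE dE; lia.
by apply/eqP/rowP => k; rewrite !mxE eqxx cE; case: (k == i) => /=; lia.
Qed.

Lemma leq_weight_step c d : step_rel c d -> weight c <= (weight d).+1.
Proof.
case/step_relP=> [dE|[i cE]]; first by apply/leqW/leq_sum => i _; rewrite dE.
by rewrite /weight (eq_bigr _ (fun k _ => cE k)) big_split /= sum_nat_pred1 addn1.
Qed.

Lemma leq_weight_path c s :
  path (@step_rel n m) c s -> weight c <= weight (last c s) + size s.
Proof.
elim: s c => [|d s IHs] c /=; first by rewrite addn0.
by case/andP=> /leq_weight_step cd /IHs ds; lia.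
Qed.

Lemma is_loop_walkE k (w : k.+1.-tuple (cube n m)) :
  is_loop_walk w = [&& sorted (@step_rel n m) w, head (origin n m) w == origin n m
                     & last (origin n m) w == origin n m].
Proof.
by rewrite /is_loop_walk !(tnth_nth (origin n m)) nth0 -nth_last size_tuple.
Qed.

End Steps.

Section Stacking.
Variables n m : nat.
Implicit Types (p q r : stacking n m) (c : cube n m) (i k : 'I_n).

Definition level p : nat := tag p.
Definition coord p i : nat := tnth (tagged p) i.

Definition stack j (x : 'I_n -> nat) : stacking n m :=
  Tagged (fun j : 'I_m.+1 => cube n j)
    ([tuple inord (x i) | i < n] : cube n (inord j : 'I_m.+1)).

Lemma level_stack j x : j <= m -> level (stack j x) = j.
Proof. exact: inordK. Qed.

Lemma coord_stack j x i : j <= m -> x i <= j -> coord (stack j x) i = x i.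
Proof. by move=> le_jm le_xj; rewrite /coord /= tnth_mktuple inordK // inordK. Qed.

Lemma level_le p : level p <= m.
Proof. exact: leq_ord. Qed.

Lemma coord_le p i : coord p i <= level p.
Proof. exact: leq_ord. Qed.

Lemma stacking_leEcoord p q :
  (p <= q)%O = (level p <= level q) && [forall i, coord p i <= coord q i].
Proof. exact: stacking_leE. Qed.

Lemma stacking_eq p q : level p = level q -> coord p =1 coord q -> p = q.
Proof.
move=> eq_lvl eq_co; apply: le_anti; rewrite !stacking_leEcoord eq_lvl leqnn.
by apply/andP; split; apply/forallP => i; rewrite eq_co.
Qed.

Lemma stack0_le p : (stack 0 (fun=> 0) <= p)%O.
Proof.
by rewrite stacking_leEcoord level_stack //; apply/forallP => i; rewrite coord_stack.
Qed.

Lemma le_stackm p : (p <= stack m (fun=> m))%O.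
Proof.
rewrite stacking_leEcoord level_stack // level_le; apply/forallP => i.
by rewrite coord_stack // (leq_trans (coord_le p i)) ?level_le.
Qed.

HB.instance Definition _ :=
  Order.hasBottom.Build stacking_display (stacking n m) stack0_le.
HB.instance Definition _ :=
  Order.hasTop.Build stacking_display (stacking n m) le_stackm.

Definition rank p : nat := level p + \sum_i coord p i.

Lemma rank_bot : rank \bot%O = 0.
Proof. by rewrite /rank level_stack // big1 // => i _; rewrite coord_stack. Qed.

Lemma rank_top : rank \top%O = (n + 1) * m.
Proof.
rewrite /rank level_stack //; under eq_bigr => i _ do rewrite coord_stack //.
by rewrite sum_nat_const card_ord; lia.
Qed.

Definition raises_level p q : Prop :=
  level q = (level p).+1 /\ coord q =1 coord p.

Definition raises_coord i p q : Prop :=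
  level q = level p /\ forall k, coord q k = coord p k + (k == i).

Definition raises p q : Prop := raises_level p q \/ exists i, raises_coord i p q.

Lemma ex_raises_level p : level p < m -> exists q, raises_level p q.
Proof.
move=> lt_pm; exists (stack (level p).+1 (coord p)).
by split=> [|i]; rewrite ?level_stack // coord_stack // leqW ?coord_le.
Qed.

Lemma ex_raises_coord p i : coord p i < level p -> exists q, raises_coord i p q.
Proof.
move=> lt_ip; exists (stack (level p) (fun k => coord p k + (k == i))).
split=> [|k]; first by rewrite level_stack ?level_le.
rewrite coord_stack ?level_le //.
by case: eqVneq => [->|_]; rewrite ?addn1 ?addn0 ?coord_le.
Qed.

Lemma raises_le p q : raises p q -> (p <= q)%O.
Proof.
rewrite stacking_leEcoord => -[[-> co]|[i [-> co]]]; rewrite ?leqnSn ?leqnn;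
  by apply/forallP => k; rewrite co ?leq_addr.
Qed.

Lemma rank_raises p q : raises p q -> rank q = (rank p).+1.
Proof.
rewrite /rank => -[[-> co]|[i [-> co]]]; rewrite (eq_bigr _ (fun k _ => co k)) //.
by rewrite big_split /= sum_nat_pred1 addnA addn1.
Qed.

Lemma lt_raises p q : (p < q)%O -> exists2 r, raises p r & (r <= q)%O.
Proof.
move=> lt_pq; have := ltW lt_pq; rewrite stacking_leEcoord.
case/andP=> le_lvl /forallP le_co; case: ltngtP le_lvl => // [lt_lvl|eq_lvl] _.
  have [r [lvl co]] := ex_raises_level (leq_trans lt_lvl (level_le q)).
  exists r; first by left.
  by rewrite stacking_leEcoord lvl lt_lvl; apply/forallP => i; rewrite co.
have [i lt_i] : exists i, coord p i < coord q i.
  apply/existsP; apply: contraTT lt_pq => /existsPn ge_co.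
  suff -> : p = q by rewrite ltxx.
  by apply: stacking_eq => // i; have := ge_co i; have := le_co i; lia.
have [|r [lvl co]] := @ex_raises_coord p i.
  by rewrite eq_lvl (leq_trans lt_i) ?coord_le.
exists r; first by right; exists i.
rewrite stacking_leEcoord lvl eq_lvl leqnn; apply/forallP => k; rewrite co.
by case: eqVneq => [->|_]; rewrite ?addn1 ?addn0.
Qed.

Lemma rank_leq p q : (p <= q)%O -> rank p <= rank q.
Proof.
rewrite stacking_leEcoord => /andP[le_lvl /forallP le_co].
by apply: leq_add => //; apply: leq_sum.
Qed.

Lemma rank_ltn p q : (p < q)%O -> rank p < rank q.
Proof. by case/lt_raises=> r /rank_raises <- /rank_leq. Qed.

Lemma covered_byP p q : reflect (raises p q) (covered_by p q).
Proof.
apply: (iffP idP) => [cov_pq|raise_pq].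
  have [r raise_pr] := lt_raises (covered_by_lt cov_pq).
  rewrite le_eqVlt => /predU1P[<- //|lt_rq].
  have eq_rp := covered_by_between cov_pq (raises_le raise_pr) lt_rq.
  by have := rank_raises raise_pr; rewrite eq_rp; lia.
have rk := rank_raises raise_pq; apply/andP; split.
  by rewrite lt_neqAle raises_le // andbT; apply: contra_eq_neq rk => ->; lia.
by apply/forallP => r; apply/negP => /andP[/rank_ltn pr /rank_ltn rq]; lia.
Qed.

Lemma rank_last_path p s : path covered_by p s -> rank (last p s) = rank p + size s.
Proof.
elim: s p => [|q s IHs] p /=; first by rewrite addn0.
by case/andP=> /covered_byP/rank_raises rk /IHs->; rewrite rk addSnnS.
Qed.

Lemma rank_top_inj p : rank p = rank \top%O -> p = \top%O.
Proof.
move=> rk; have := lex1 p; rewrite le_eqVlt => /predU1P[//|/rank_ltn].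
by rewrite rk ltnn.
Qed.

Definition gap p : cube n m := [tuple inord (level p - coord p i) | i < n].

Lemma tnth_gap p i : tnth (gap p) i = level p - coord p i :> nat.
Proof.
by rewrite tnth_mktuple inordK // ltnS (leq_trans (leq_subr _ _)) ?level_le.
Qed.

Lemma eq_gap p c :
  (forall i, level p = tnth c i + coord p i) -> gap p = c.
Proof.
move=> lvl; apply: eq_from_tnth => i; apply: val_inj => /=.
by rewrite tnth_gap (lvl i) addnK.
Qed.

Lemma gap_bot : gap \bot%O = origin n m.
Proof.
by apply: eq_gap => i; rewrite level_stack // coord_stack // tnth_mktuple.
Qed.

Lemma gap_top : gap \top%O = origin n m.
Proof.
by apply: eq_gap => i; rewrite level_stack // coord_stack // tnth_mktuple.
Qed.

Lemma rank_gap p : rank p + weight (gap p) = (n + 1) * level p.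
Proof.
rewrite /rank -addnA -big_split /=.
under eq_bigr => i _ do rewrite tnth_gap subnKC ?coord_le //.
by rewrite sum_nat_const card_ord; lia.
Qed.

Lemma rank_gap_inj p q : rank p = rank q -> gap p = gap q -> p = q.
Proof.
move=> eq_rk eq_gp; have eq_lvl : level p = level q.
  by have := rank_gap p; rewrite eq_rk eq_gp rank_gap; nia.
apply: stacking_eq => // i; have := tnth_gap p i.
by rewrite eq_gp tnth_gap eq_lvl; have := coord_le p i; have := coord_le q i; lia.
Qed.

Lemma step_rel_gap p q : covered_by p q -> step_rel (gap p) (gap q).
Proof.
move=> cov; apply/step_relP; case/covered_byP: cov => [[lvl co]|[i [lvl co]]].
  by left=> i; rewrite !tnth_gap lvl co subSn ?coord_le.
right; exists i => k; rewrite !tnth_gap.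
by have := coord_le q k; rewrite lvl co; lia.
Qed.

Lemma gap_covered_inj p q r :
  covered_by p q -> covered_by p r -> gap q = gap r -> q = r.
Proof.
move=> /covered_byP/rank_raises rkq /covered_byP/rank_raises rkr.
by apply: rank_gap_inj; rewrite rkq rkr.
Qed.

(* By [rank_gap], the bound says that the lifted point has level at most [m]. *)
Lemma step_lift p c :
    step_rel (gap p) c -> (rank p).+1 + weight c <= (n + 1) * m ->
  exists2 q, covered_by p q & gap q = c.
Proof.
case/step_relP=> [cE|[i cE]] bound.
  have [|q [lvl co]] := @ex_raises_level p.
    have := rank_gap p; have : weight c = weight (gap p) + n; last by nia.
    rewrite /weight; under eq_bigr => i _ do rewrite cE -addn1.
    by rewrite big_split /= sum_nat_const card_ord muln1.
  exists q; first by apply/covered_byP; left.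
  by apply: eq_gap => i; rewrite lvl co cE tnth_gap addSn subnK ?coord_le.
have [|q [lvl co]] := @ex_raises_coord p i.
  by have := cE i; rewrite tnth_gap eqxx; lia.
exists q; first by apply/covered_byP; right; exists i.
apply: eq_gap => k; rewrite lvl co.
by have := cE k; rewrite tnth_gap; have := coord_le p k; lia.
Qed.

Lemma path_lift p s :
    path (@step_rel n m) (gap p) s -> last (gap p) s = origin n m ->
    rank p + size s <= (n + 1) * m ->
  exists2 t, path covered_by p t & map gap t = s.
Proof.
elim: s p => [|c s IHs] p /=; first by exists [::].
case/andP=> pc cs c_s bound.
have [|q cov_pq gap_q] := step_lift pc.
  by have := leq_weight_path cs; rewrite c_s weight_origin; lia.
rewrite -gap_q in cs c_s; have [|t cov_qt <-] := IHs q cs c_s.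
  by rewrite (rank_raises (covered_byP _ _ cov_pq)) addSnnS.
by exists (q :: t); rewrite /= ?cov_pq ?gap_q.
Qed.

Definition walk_of_chain (A : {set stacking n m}) : seq (cube n m) :=
  map gap (Order.enum A).

Lemma size_walk_of_chain A :
  is_max_chain A -> size (walk_of_chain A) == ((n + 1) * m).+1.
Proof.
case/enum_max_chain=> s [enumA /rank_last_path + s_top].
by rewrite size_map enumA s_top rank_top rank_bot /= => ->.
Qed.

Lemma walk_of_chain_loop A (maxA : is_max_chain A) :
  is_loop_walk (Tuple (size_walk_of_chain maxA)).
Proof.
have [s [enumA s_cov s_top]] := enum_max_chain maxA.
rewrite is_loop_walkE /= /walk_of_chain enumA /= last_map s_top gap_bot gap_top.
by rewrite eqxx !andbT -gap_bot; apply: homo_path s_cov; apply: step_rel_gap.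
Qed.

Lemma walk_of_chain_inj :
  {in @is_max_chain _ (stacking n m) &, injective walk_of_chain}.
Proof.
move=> A B /enum_max_chain[s [enumA s_cov _]] /enum_max_chain[t [enumB t_cov _]].
rewrite /walk_of_chain enumA enumB.
case=> /(path_map_inj gap_covered_inj s_cov t_cov) eq_st.
by rewrite -[LHS]Order.set_enum -[RHS]Order.set_enum enumA enumB eq_st.
Qed.

Lemma walk_of_chain_surj (w : ((n + 1) * m).+1.-tuple (cube n m)) :
  is_loop_walk w -> exists2 A, is_max_chain A & walk_of_chain A = w.
Proof.
rewrite is_loop_walkE; case: w => -[//|c s] /= /eqP[size_s].
case/and3P=> cs /eqP c0 /eqP s0.
rewrite c0 -gap_bot in cs s0 *.
have [||t t_cov t_s] := path_lift cs; first by rewrite s0 gap_bot.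
  by rewrite rank_bot size_s.
have t_top : last \bot%O t = \top%O.
  apply: rank_top_inj.
  by rewrite (rank_last_path t_cov) rank_bot rank_top -size_s -t_s size_map.
exists [set p in \bot%O :: t]; first exact: covered_path_max_chain.
rewrite /walk_of_chain enum_sorted /= ?t_s //.
by apply: sub_path t_cov; apply: covered_by_lt.
Qed.

End Stacking.

Theorem theorem5p2 (n m : nat) :
  exists f : {A : {set stacking n m} | is_max_chain A} ->
             {w : ((n + 1) * m).+1.-tuple (cube n m) | is_loop_walk w},
    bijective f.
Proof.
pose f (A : {A : {set stacking n m} | is_max_chain A}) :
    {w : ((n + 1) * m).+1.-tuple (cube n m) | is_loop_walk w} :=
  exist _ (Tuple (size_walk_of_chain (valP A))) (walk_of_chain_loop (valP A)).
have f_inj : injective f.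
  move=> A B /(congr1 (fun w => tval (val w))) /= eq_walk.
  exact/val_inj/(walk_of_chain_inj (valP A) (valP B)).
have f_surj w : exists A, f A = w.
  have [A maxA walkA] := walk_of_chain_surj (valP w).
  by exists (exist _ A maxA); apply/val_inj/val_inj.
have [g fK] := fin_all_exists f_surj.
by exists f, g => // A; apply: f_inj.
Qed.
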